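(* Let $n, k, t$ be positive integers satisfying $t < \frac{n}{3k^2}$. Then every $k$-uniform hypergraph on $n$ vertices that does not contain $t$ pairwise disjoint edges has at most $\binom{n}{k} - \binom{n-t+1}{k}$ edges.
   Context: A $k$-uniform hypergraph is a pair $H=(V,E)$, where $V$ is a finite set of vertices and $E \subseteq \binom{V}{k}$ is a set of $k$-element subsets of $V$ called edges (no repeated edges). *)

(* Defs.v *)
From mathcomp Require Import all_boot all_order all_algebra.

Set Implicit Arguments.
Unset Strict Implicit.
Unset Printing Implicit Defensive.

(* A hypergraph on the vertex set T is given by its set of edges
   E : {set {set T}}; being a set, it has no repeated edges. *)

Definition uniform_hypergraph (T : finType) (k : nat) (E : {set {set T}}) : Prop :=
  forall e : {set T}, e \in E -> #|e| = k.

(* The t edges form a set M of cardinal t, so they are distinct; for k > 0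
   pairwise disjoint edges are nonempty, hence automatically distinct. *)
Definition has_disjoint_edges (T : finType) (t : nat) (E : {set {set T}}) : Prop :=
  exists M : {set {set T}}, [/\ M \subset E, #|M| = t & trivIset M].

(* Main.v *)
Require Import Defs.
From mathcomp Require Import all_boot all_order all_algebra all_fingroup.
From mathcomp Require Import zify ring lra.

(** Write [c] for the number ['C(n - 2, k - 2)] of [k]-sets through two given
    points.  The proof, due to Huang, Loh and Sudakov, is by induction on [t]
    and compares vertex degrees with multiples of [t * c].

    If some vertex [v] has degree above [k * (t - 1) * c], deleting it leaves
    more edges than the bound for [n - 1] and [t - 1], so induction gives
    [t - 1] disjoint edges missing [v].  They cover [k * (t - 1)] points, hence
    meet at most [k * (t - 1) * c] of the edges through [v], and some edge
    through [v] completes them to [t] disjoint edges ([heavy_vertex]).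

    Otherwise all degrees are at most [k * (t - 1) * c].  The crucial point is
    that fewer than [t] vertices have degree above [2 * (t - 1) * c]
    ([many_heavy_vertices]).  So, if there are no [t] disjoint edges, the at
    most [k * (t - 1)] points covered by a maximal matching, which every edge
    must meet, have total degree at most [3 * k * (t - 1) ^ 2 * c]
    ([light_hypergraph]).  As [n > 3 * k ^ 2 * t], this is below
    ['C(n, k) - 'C(n - t + 1, k)] ([leq_light_bound]).

    The bound on heavy vertices comes from a rainbow matching theorem
    ([rainbow_star]): if [F_0, ..., F_(t-1)] are families of [k_i]-subsets of an
    [m]-set, [k_0 + ... + k_(t-1) <= m], and each [F_i] has more than [t - 1]
    times as many members as there are [k_i]-sets through a point, then one can
    pick pairwise disjoint members, one in each family.  Given [t] heavy
    vertices [v_i], it is applied to the links of the [v_i], restricted to the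
    complement of all the heavy vertices.  When [k_0 + ... + k_(t-1) = m] the
    rainbow theorem holds by averaging over ordered partitions of the [m]-set:
    the probabilities that the [i]-th block is not in [F_i] add up to less than 1.
    When [k_0 + ... + k_(t-1) < m], shifting the families away from a point [x]
    and then deleting [x], from the ground set and from the members of some of
    the families, reduces [m] by 1. *)

Set Implicit Arguments.
Unset Strict Implicit.
Unset Printing Implicit Defensive.

Import Order.TTheory GRing.Theory Num.Theory.

(** * Counting subsets through given points *)

(** The number of [k]-subsets of an [m]-set that contain [j] given points.  The
    test matters: the truncated [k - j] would give 1 instead of 0 when [k < j],
    and families of sets of size 0 and 1 do occur in the inductions. *)
Definition bin_over j m k := if j <= k then 'C(m - j, k - j) else 0.

(** Pascal's rule: a further point either belongs to the set or does not. *)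
Lemma bin_over_rec j m k : j < m ->
  bin_over j m k = bin_over j.+1 m k + bin_over j m.-1 k.
Proof.
move=> jm; rewrite /bin_over.
have -> : m.-1 - j = m - j.+1 by lia.
have -> : m - j = (m - j.+1).+1 by lia.
case: (ltngtP j k) => // jk; last by rewrite jk subnn !bin0.
have -> : k - j = (k - j.+1).+1 by lia.
by rewrite binS addnC.
Qed.

Lemma bin_overSS j m k : bin_over j.+1 m.+1 k.+1 = bin_over j m k.
Proof. by rewrite /bin_over !subSS. Qed.

Lemma leq_bin_over j m m' k : m <= m' -> bin_over j m k <= bin_over j m' k.
Proof. by move=> le_m; rewrite /bin_over; case: ifP => // _; apply: leq_bin2l; lia. Qed.

(** Double counting of the pairs formed by a [k]-set and one of its points. *)
Lemma mul_bin_over1 m k : k * 'C(m, k) = m * bin_over 1 m k.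
Proof.
case: k => [|k]; first by rewrite mul0n muln0.
case: m => [|m]; first by rewrite mul0n muln0.
by rewrite /bin_over /= !subSS !subn0 -mul_bin_diag.
Qed.

Lemma bin_over1_sub n k s : s < n ->
  bin_over 1 n k <= bin_over 1 (n - s) k + s * bin_over 2 n k.
Proof.
elim: s => [|s IHs] sn; first by rewrite subn0 addn0.
apply: leq_trans (IHs (ltnW sn)) _.
rewrite (@bin_over_rec 1 (n - s)); last by lia.
have -> : (n - s).-1 = n - s.+1 by lia.
have := @leq_bin_over 2 (n - s) n k (leq_subr _ _).
rewrite mulSn; lia.
Qed.

(** The sets meeting a given [s]-set, counted at their first point in it; each
    of these [s] counts falls short of [bin_over 1 n k] by at most
    [s * bin_over 2 n k]. *)
Lemma bin_sub_lower n k s : s < n ->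
  'C(n - s, k) + s * bin_over 1 n k <= 'C(n, k) + s ^ 2 * bin_over 2 n k.
Proof.
elim: s => [|s IHs] sn; first by rewrite subn0 !mul0n.
have := IHs (ltnW sn); have := bin_over1_sub k (ltnW sn).
have := @bin_over_rec 0 (n - s) k ltac:(lia).
rewrite [bin_over 0 _ _]/bin_over [bin_over 0 _.-1 _]/bin_over /= !subn0.
have -> : (n - s).-1 = n - s.+1 by lia.
move: (bin_over 1 n k) (bin_over 2 n k) (bin_over 1 (n - s) k) => a b c.
move: ('C(n, k)) ('C(n - s, k)) ('C(n - s.+1, k)) => x y z.
nia.
Qed.

(** The ratio [bin_over 1 n k / bin_over 2 n k] is [(n - 1) / (k - 1)], and
    [(k - 1) * (3 * k + 1) <= 3 * k ^ 2]. *)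
Lemma bin_over2_le n k s : 0 < k -> 3 * k ^ 2 * s < n ->
  (3 * k + 1) * s * bin_over 2 n k <= bin_over 1 n k.
Proof.
case: k => // -[|k] _; first by rewrite [bin_over 2 n 1]/bin_over /= muln0.
case: n => // n ltn; rewrite bin_overSS -(leq_pmul2l (ltn0Sn k)).
have -> : bin_over 1 n.+1 k.+2 = 'C(n, k.+1) by rewrite /bin_over /= !subSS !subn0.
rewrite mul_bin_over1 mulnA leq_mul2r; apply/orP; right; nia.
Qed.

(** This is where the hypothesis on [t] enters: it makes the edge count of a
    hypergraph without vertices of large degree fall below the extremal one. *)
Lemma leq_light_bound n k s : 0 < k -> 3 * k ^ 2 * s < n ->
  3 * k * s ^ 2 * bin_over 2 n k <= 'C(n, k) - 'C(n - s, k).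
Proof.
move=> k0 ks; have sn : s < n by nia.
have lo := bin_sub_lower k sn.
have := leq_mul (leqnn s) (bin_over2_le k0 ks).
have -> : s * ((3 * k + 1) * s * bin_over 2 n k) =
  3 * k * s ^ 2 * bin_over 2 n k + s ^ 2 * bin_over 2 n k by ring.
move: (3 * k * s ^ 2 * _) (s ^ 2 * _) (s * bin_over _ _ _) lo => a b c.
lia.
Qed.

Definition ksets (T : finType) (V : {set T}) k : {set {set T}} :=
  [set A : {set T} | A \subset V & #|A| == k].

Section RainbowMatchings.
Variable T : finType.
Implicit Types (x j : T) (V A B J : {set T}) (F : nat -> {set {set T}}).
Implicit Types (G : {set {set T}}).

Lemma card_ksets V k : #|ksets V k| = 'C(#|V|, k).
Proof. exact: cards_draws. Qed.

Lemma card_over V J k G : G \subset ksets V k -> J \subset V ->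
  #|[set A in G | J \subset A]| <= bin_over #|J| #|V| k.
Proof.
move=> GV sJV; rewrite /bin_over; case: (leqP #|J| k) => [Jk|kJ]; last first.
  rewrite /= leqn0 cards_eq0; apply/eqP/setP => A; rewrite !inE.
  apply/negP => /andP[/(subsetP GV)]; rewrite inE => /andP[_ /eqP cA] /subset_leq_card.
  by rewrite cA leqNgt kJ.
rewrite -[#|V| - _](_ : #|V :\: J| = _); last by rewrite cardsD (setIidPr sJV).
rewrite -card_ksets.
rewrite -(card_in_imset (f := fun A => A :\: J)).
  apply: subset_leq_card; apply/subsetP => _ /imsetP[A + ->]; rewrite !inE.
  move=> /andP[/(subsetP GV)]; rewrite inE => /andP[AV /eqP cA] sJA.
  by rewrite setSD //= cardsD (setIidPr sJA) cA.
move=> A B; rewrite !inE => /andP[_ JA] /andP[_ JB] e.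
by rewrite -(setID A J) -(setID B J) e (setIidPr JA) (setIidPr JB).
Qed.

(** * Rainbow matchings by averaging *)

(** Indexing by [nat] rather than by ['I_t] avoids reindexing in inductions on
    [t]. *)
Definition rainbow t F :=
  exists A : nat -> {set T}, (forall i, i < t -> A i \in F i) /\
    (forall i l, i < t -> l < t -> i != l -> [disjoint A i & A l]).

(** Double counting of the disjoint pairs [(A, B)] with [B] in [G]. *)
Lemma sum_card_disjoint V a b (G : {set {set T}}) : G \subset ksets V b ->
  \sum_(A in ksets V a) #|[set B in G | [disjoint B & A]]| = #|G| * 'C(#|V| - b, a).
Proof.
move=> sGV.
under eq_bigr do rewrite -sum1_card.
rewrite (exchange_big_dep (mem G)) /=; last by move=> A B _; rewrite inE => /andP[].
rewrite -sum_nat_const; apply: eq_bigr => B BG.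
have /setIdP[sBV /eqP cB] := subsetP sGV _ BG.
rewrite sum1_card -cB -(setIidPr sBV) -cardsD -card_ksets.
apply: eq_card => A; rewrite unfold_in.
rewrite (setIidPr sBV) !inE BG subsetD (disjoint_sym B).
by rewrite andbAC.
Qed.

(** Both sides count the ordered pairs of disjoint sets of sizes [a] and [b]. *)
Lemma bin_trinomialC m a b : a + b <= m ->
  'C(m, a) * 'C(m - a, b) = 'C(m, b) * 'C(m - b, a).
Proof.
move=> abm; apply/eqP.
rewrite -(eqn_pmul2r (fact_gt0 a)) -(eqn_pmul2r (fact_gt0 b)).
rewrite -(eqn_pmul2r (fact_gt0 (m - a - b))); apply/eqP.
have Ea := @bin_fact m a ltac:(lia); have Eb := @bin_fact m b ltac:(lia).
have Eab := @bin_fact (m - a) b ltac:(lia); have Eba := @bin_fact (m - b) a ltac:(lia).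
have e : m - b - a = m - a - b by lia.
rewrite e in Eba.
transitivity (m`!).
  by rewrite -[RHS]Ea -Eab; ring.
by rewrite -[LHS]Eb -Eba; ring.
Qed.

(** In a random choice of disjoint blocks of sizes [k i], the [i]-th block is not
    in [F i] with probability [1 - #|F i| / 'C(#|V|, k i)]; if these
    probabilities add up to less than 1, some choice succeeds everywhere.  The random choice
    is derandomized one block at a time, the last one first. *)
Lemma rainbow_density t F (k : nat -> nat) V :
    (forall i, i < t -> F i \subset ksets V (k i)) -> \sum_(i < t) k i <= #|V| ->
    (\sum_(i < t) (1 - #|F i|%:R / 'C(#|V|, k i)%:R) < 1 :> rat)%R ->
  rainbow t F.
Proof.
elim: t F V => [|t IHt] F V FV kV dF; first by exists (fun=> set0).
rewrite big_ord_recr /= in kV; rewrite big_ord_recr /= in dF.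
set a := k t in kV dF; set m := #|V| in kV dF.
have ale : a <= m by apply: leq_trans kV; exact: leq_addl.
have kle (i : 'I_t) : k i + a <= m.
  by apply: leq_trans kV; rewrite leq_add2r (bigD1 i) //= leq_addr.
pose R A i := [set B in F i | [disjoint B & A]].
(* The expected number of failures once the last block is fixed to be [A];
   its average over [A] is the sum bounded by [dF]. *)
pose f A : rat := (\sum_(i < t) (1 - #|R A i|%:R / 'C(m - a, k i)%:R)
                    + (A \notin F t)%:R)%R.
have Cpos u v : v <= u -> ('C(u, v)%:R != 0 :> rat)%R.
  by move=> vu; rewrite pnatr_eq0 -lt0n bin_gt0.
have sumf : (\sum_(A in ksets V a) f A < \sum_(A in ksets V a) 1)%R.
  rewrite [ltRHS]sumr_const card_ksets -/m.
  suff -> : (\sum_(A in ksets V a) f A = 'C(m, a)%:R *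
     (\sum_(i < t) (1 - #|F i|%:R / 'C(m, k i)%:R) + (1 - #|F t|%:R / 'C(m, a)%:R)))%R.
    rewrite -[ltRHS]mulr1 ltr_pM2l // ltr0n bin_gt0; lia.
  rewrite big_split /= mulrDr; congr (_ + _)%R.
    rewrite exchange_big /= mulr_sumr; apply: eq_bigr => i _.
    rewrite sumrB sumr_const card_ksets -/m mulrBr mulr1; congr (_ - _)%R.
    rewrite -mulr_suml -natr_sum /R (sum_card_disjoint _ (FV i (ltnW (ltn_ord i)))).
    have := bin_trinomialC (kle i) => /(congr1 (fun n => n%:R : rat)%R).
    rewrite -/m !natrM => e.
    have c1 := @Cpos (m - a) (k i) ltac:(have := kle i; lia).
    have c2 := @Cpos m (k i) ltac:(have := kle i; lia).
    apply/eqP; rewrite mulrA eqr_div //; apply/eqP; ring: e.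
  rewrite mulrBr mulr1 mulrCA divff ?Cpos // mulr1.
  rewrite -/m -card_ksets -(cardsID (F t) (ksets V a)) (setIidPr (FV t _)) //.
  rewrite natrD [(_ + #|_ :\: _|%:R)%R]addrC addrK -natr_sum; congr (_%:R)%R.
  rewrite -sum1_card big_mkcond [RHS]big_mkcond; apply: eq_bigr => A _.
  by rewrite [A \in _ :\: _]inE; case: (A \in ksets V a); case: (A \in F t).
have [A AV fA] : exists2 A, A \in ksets V a & (f A < 1)%R.
  case: (boolP [exists A, (A \in ksets V a) && (f A < 1)%R]).
    by move=> /existsP[A /andP[]]; exists A.
  move=> /existsPn none.
  suff : (\sum_(A in ksets V a) f A < \sum_(A in ksets V a) f A)%R by rewrite ltxx.
  apply: lt_le_trans sumf _; apply: ler_sum => A AV.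
  by have := none A; rewrite AV -leNgt.
have /setIdP[sAV /eqP cA] := AV.
have cD : #|V :\: A| = m - a by rewrite cardsD (setIidPr sAV) cA.
have RV i : i < t -> R A i \subset ksets (V :\: A) (k i).
  move=> it; apply/subsetP => B; rewrite !inE => /andP[BF dBA].
  by have := subsetP (FV i (ltnW it)) _ BF; rewrite !inE subsetD dBA andbT.
have f0 : (0 <= \sum_(i < t) (1 - #|R A i|%:R / 'C(m - a, k i)%:R) :> rat)%R.
  apply: sumr_ge0 => i _; rewrite subr_ge0 ler_pdivrMr; last first.
    by rewrite ltr0n bin_gt0; have := kle i; lia.
  by rewrite mul1r ler_nat -cD -card_ksets subset_leq_card ?RV.
have AF : A \in F t.
  by move: fA f0; rewrite /f; case: (A \in F t) => //=; lra.
have [||B [BR dB]] := IHt (R A) (V :\: A) RV.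
- by rewrite cD leq_subRL // addnC.
- by rewrite cD; move: fA; rewrite /f AF addr0.
exists (fun i => if i < t then B i else A); split=> [i|i l].
  rewrite ltnS leq_eqVlt => /predU1P[->|it]; first by rewrite ltnn.
  by rewrite it; have := BR i it; rewrite inE => /andP[].
have dBA u : u < t -> [disjoint B u & A].
  by move=> ut; have := BR u ut; rewrite inE => /andP[].
move=> it lt nil; case: ifP => i't; case: ifP => l't.
- exact: dB.
- exact: dBA.
- by rewrite disjoint_sym; exact: dBA.
- by case/eqP: nil; lia.
Qed.

(** * Shifting *)

Definition swap j x A := tperm j x @^-1: A.

Lemma swapK j x : involutive (swap j x).
Proof. by move=> A; apply/setP => y; rewrite !inE tpermK. Qed.

Lemma card_swap j x A : #|swap j x A| = #|A|.
Proof. exact: card_preimset perm_inj. Qed.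

Lemma swap_id j x A : (j \in A) = (x \in A) -> swap j x A = A.
Proof. by move=> e; apply/setP => y; rewrite inE; case: tpermP => // ->. Qed.

(** The compression replacing [x] by [j] in the members of [G] that contain [x]
    but not [j], unless the result is already in [G].  Sets containing both
    points or neither are fixed by [swap j x], so they need no separate case. *)
Definition shift j x G := [set A : {set T} |
  if x \in A then (A \in G) && (swap j x A \in G) else (A \in G) || (swap j x A \in G)].

(** On each orbit [{A, swap j x A}], [shift] keeps the number of members. *)
Lemma card_shift j x G : #|shift j x G| = #|G|.
Proof.
have dbl (H : {set {set T}}) : #|H|.*2 = \sum_A ((A \in H) + (swap j x A \in H)).
  have c : #|H| = \sum_A (A \in H) by rewrite -sum1_card big_mkcond.
  by rewrite big_split /= -addnn {1}c c (reindex_inj (inv_inj (@swapK j x))).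
apply: double_inj; rewrite !dbl; apply: eq_bigr => A _.
case: (eqVneq (j \in A) (x \in A)) => [e|].
  by rewrite !swap_id // inE swap_id //; case: ifP; rewrite (andbb, orbb).
rewrite !inE swapK tpermR.
by case: (j \in A); case: (x \in A) => // _; case: (A \in G); case: (swap _ _ _ \in G).
Qed.

Lemma shift_sub j x G V k : j \in V -> x \in V ->
  G \subset ksets V k -> shift j x G \subset ksets V k.
Proof.
move=> jV xV GV; apply/subsetP => A AS.
suff [//|] : A \in ksets V k \/ swap j x A \in ksets V k.
  rewrite !inE card_swap => /andP[sV ->]; rewrite andbT.
  apply/subsetP => y yA; have := subsetP sV (tperm j x y).
  by rewrite inE tpermK => /(_ yA); case: tpermP => // ->.
move: AS; rewrite inE; case: ifP => _.
  by case/andP => /(subsetP GV); left.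
by case/orP => /(subsetP GV); [left|right].
Qed.

(** If a rainbow matching [A] of the shifted families is not one of the original
    families, then its image under [swap j x] is.  Indeed some [A i0] is a new
    set, so [A i0] contains [j] and its image is in [F i0]; any other [A i] avoids
    [j], so either it avoids [x] as well and is not moved, or it contains [x] and
    survived the shift because its image was already in [F i]. *)
Lemma rainbow_shift t j x F : rainbow t (fun i => shift j x (F i)) -> rainbow t F.
Proof.
case=> A [AS dA].
case: (boolP [forall i : 'I_t, A i \in F i]) => [/forallP AF|].
  by exists A; split=> // i it; exact: AF (Ordinal it).
case/forallPn => i0 AF0.
have := AS i0 (ltn_ord i0); rewrite inE (negPf AF0) /=; case: ifP => // xA0 sA0.
have jA0 : j \in A i0.
  by apply: contraR AF0 => jA; rewrite -(@swap_id j x (A i0)) // xA0 (negPf jA).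
exists (fun i => swap j x (A i)); split=> [i it|i l it lt nil]; last first.
  by rewrite -setI_eq0 -preimsetI (disjoint_setI0 (dA _ _ it lt nil)) preimset0.
have := AS i it; rewrite inE; case: ifP => [_ /andP[] //|xA].
have [->|ni0] := eqVneq i i0; first by rewrite sA0.
have jA : j \notin A i by have := dA _ _ (ltn_ord i0) it; rewrite eq_sym => /(_ ni0) /disjointFr ->.
by rewrite swap_id ?orbb // xA (negPf jA).
Qed.

(** No shift away from [x] within [V] changes [G]. *)
Definition stable V x G := forall j A, j \in V -> A \in G -> x \in A -> swap j x A \in G.

(** Every shift that changes some family strictly decreases the total number of
    members through [x], so shifting terminates. *)
Lemma rainbow_wlog_stable t V x F (k : nat -> nat) : x \in V ->
    (forall i, i < t -> F i \subset ksets V (k i)) ->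
    (forall F', (forall i, i < t -> F' i \subset ksets V (k i)) ->
      (forall i, i < t -> #|F' i| = #|F i|) ->
      (forall i, i < t -> stable V x (F' i)) -> rainbow t F') ->
  rainbow t F.
Proof.
move=> xV.
have [n] := ubnP (\sum_(i < t) #|[set A in F i | x \in A]|).
elim: n F => // n IHn F Fn FV IH.
case: (boolP [forall i : 'I_t, forall j in V, forall A in F i,
                (x \in A) ==> (swap j x A \in F i)]).
  move=> st; apply: IH => // i it j A jV AF xA.
  have /forallP/(_ (Ordinal it))/forall_inP/(_ j jV)/forall_inP/(_ A AF) := st.
  by rewrite xA.
case/forallPn=> i0 /forall_inPn[j jV] /forall_inPn[A0 A0F]; rewrite negb_imply => /andP[xA0 sA0].
apply: (@rainbow_shift _ j x); apply: IHn.
- rewrite -ltnS; apply: leq_trans Fn; rewrite ltnS.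
  have sub (i : 'I_t) : [set A in shift j x (F i) | x \in A] \subset [set A in F i | x \in A].
    apply/subsetP => A; rewrite !inE; case: ifP => //= _.
    + by rewrite !andbT => /andP[].
    + by rewrite andbF.
  rewrite (bigD1 i0) //= [ltnRHS](bigD1 i0) //= -addSn leq_add //.
    apply: proper_card; rewrite properE sub; apply/subsetPn; exists A0.
      by rewrite inE A0F.
    by rewrite !inE xA0 A0F (negPf sA0).
  by apply: leq_sum => i _; apply: subset_leq_card.
- by move=> i it; apply: shift_sub => //; exact: FV.
- move=> F' F'V cF'; apply: IH => // i it.
  by rewrite cF' // card_shift.
Qed.

(** * The rainbow matching theorem *)

Lemma leq_card_bigcup (I : finType) (P : pred I) (A : I -> {set T}) :
  #|\bigcup_(i | P i) A i| <= \sum_(i | P i) #|A i|.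
Proof.
elim/big_rec2: _ => [|i n B _ le_n]; first by rewrite cards0.
by apply: leq_trans (leq_card_setU _ _) _; rewrite leq_add2l.
Qed.

Lemma disjoint_setU1 x A B : [disjoint x |: A & B] = (x \notin B) && [disjoint A & B].
Proof. by rewrite -disjointU1; apply: eq_disjoint => y; rewrite !inE. Qed.

(** For nonempty [V], [#|F i| / 'C(#|V|, k i)] exceeds [(t - 1) * k i / #|V|], and the latter
    numbers add up to [t - 1], so [rainbow_density] applies. *)
Lemma rainbow_star_tight t V F (k : nat -> nat) :
    (forall i, i < t -> F i \subset ksets V (k i)) -> \sum_(i < t) k i = #|V| ->
    (forall i, i < t -> t.-1 * bin_over 1 #|V| (k i) < #|F i|) ->
  rainbow t F.
Proof.
case: t => [|t] FV kV bF; first by exists (fun=> set0).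
apply: (@rainbow_density t.+1 F k V) => //; first by rewrite kV.
have kle (i : 'I_t.+1) : k i <= #|V| by rewrite -kV (bigD1 i) //= leq_addr.
have Cpos (i : 'I_t.+1) : (0 < 'C(#|V|, k i)%:R :> rat)%R by rewrite ltr0n bin_gt0 kle.
case: (posnP #|V|) => [V0|V0].
  apply: (@le_lt_trans _ _ 0%R) => //; apply: sumr_le0 => i _.
  rewrite subr_le0 ler_pdivlMr // mul1r ler_nat.
  have := kle i; rewrite V0 leqn0 => /eqP->; rewrite bin0.
  exact: leq_ltn_trans (bF i (ltn_ord i)).
have V0q : (0 < #|V|%:R :> rat)%R by rewrite ltr0n.
have lt_sum : (\sum_(i < t.+1) (1 - #|F i|%:R / 'C(#|V|, k i)%:R) <
    \sum_(i < t.+1) (1 - t%:R * (k i)%:R / #|V|%:R) :> rat)%R.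
  apply: ltr_sum => [|i _]; first by apply/hasP; exists ord0; rewrite ?mem_index_enum.
  rewrite ltrD2l ltrN2 ltr_pdivlMr // mulrAC ltr_pdivrMr // -!natrM ltr_nat.
  rewrite -mulnA mul_bin_over1 mulnCA [ltnRHS]mulnC ltn_pmul2l //.
  exact: bF.
apply: lt_le_trans lt_sum _.
rewrite sumrB sumr_const card_ord -mulr_suml -mulr_sumr -natr_sum kV mulfK ?gt_eqF //.
by rewrite -natr1 addrC addKr.
Qed.

Lemma size_filter_iota (b : pred nat) t :
  size [seq i <- iota 0 t | b i] = \sum_(i < t) b i.
Proof.
rewrite size_filter -sum1_count big_mkcond /=.
by rewrite -(big_mkord xpredT (fun i => nat_of_bool (b i))) /index_iota subn0.
Qed.

(** Where [b i] fails, a member of [G i] is a member of [F i] deprived of [x].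
    By stability any point of [V] outside the matching, [x] included, can stand
    in for [x], and the condition on the sizes [k i] leaves enough free points to
    use different ones for different indices. *)
Lemma rainbow_refill t V x F (k k' : nat -> nat) (b : pred nat) (G : nat -> {set {set T}}) :
    x \in V -> \sum_(i < t) k i <= #|V| ->
    (forall i, i < t -> G i \subset ksets (V :\ x) (k' i)) ->
    (forall i, i < t -> stable V x (F i)) ->
    (forall i A, i < t -> b i -> A \in G i -> A \in F i) ->
    (forall i A, i < t -> ~~ b i -> A \in G i -> x |: A \in F i) ->
    (forall i, i < t -> k i = k' i + ~~ b i) ->
  rainbow t G -> rainbow t F.
Proof.
move=> xV kV GV stF bF nbF kk' [A [AG dA]].
pose s := [seq i <- iota 0 t | ~~ b i].
pose U := \bigcup_(i < t) A i; pose W := V :\: U.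
have AV i : i < t -> A i \subset V :\ x /\ #|A i| = k' i.
  by move=> it; have := subsetP (GV i it) _ (AG i it); rewrite inE => /andP[-> /eqP].
have sUV : U \subset V.
  by apply/bigcupsP => i _; apply: subset_trans (AV i (ltn_ord i)).1 (subD1set _ _).
have sW : size s <= size (enum W).
  rewrite -cardE cardsD (setIidPr sUV) leq_subRL ?subset_leq_card //.
  apply: leq_trans kV; rewrite size_filter_iota addnC.
  apply: leq_trans (_ : \sum_(i < t) (~~ b i) + \sum_(i < t) k' i <= _).
    rewrite leq_add2l; apply: leq_trans (leq_card_bigcup _ _) _.
    by apply: leq_sum => i _; rewrite (AV i _).2.
  by rewrite -big_split /=; apply: leq_sum => i _; rewrite kk' // addnC.
(* By [sW], the default [x] is not used at the indices where [b] fails. *)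
pose y i := nth x (enum W) (index i s).
have is_s i : i < t -> ~~ b i -> i \in s by move=> it nb; rewrite mem_filter nb mem_iota.
have ys i : i < t -> ~~ b i -> index i s < size (enum W).
  by move=> it nb; apply: leq_trans sW; rewrite index_mem is_s.
have yW i : i < t -> ~~ b i -> y i \in W by move=> it nb; rewrite -mem_enum mem_nth ?ys.
have yinj i l : i < t -> l < t -> ~~ b i -> ~~ b l -> y i = y l -> i = l.
  move=> it lt nbi nbl /eqP; rewrite nth_uniq ?enum_uniq ?ys // => /eqP e.
  by rewrite -(nth_index 0 (is_s i it nbi)) e nth_index // is_s.
have yA i l : i < t -> l < t -> ~~ b i -> y i \notin A l.
  move=> it lt nbi; have := yW i it nbi; rewrite inE => /andP[+ _].
  by apply: contra => yAl; apply/bigcupP; exists (Ordinal lt).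
exists (fun i => if b i then A i else y i |: A i); split=> [i it|i l it lt nil].
  case: ifPn => nb; first by apply: bF => //; exact: AG.
  have yV : y i \in V by have := yW i it nb; rewrite inE => /andP[].
  have := stF i it (y i) (x |: A i) yV (nbF i _ it nb (AG i it)) (setU11 _ _).
  suff -> : swap (y i) x (x |: A i) = y i |: A i by [].
  have xA : x \notin A i by apply/negP => /(subsetP (AV i it).1); rewrite !inE eqxx.
  apply/setP => z; rewrite !inE.
  case: tpermP => [->|->|/eqP /negPf -> /eqP/negPf -> //]; rewrite ?eqxx //.
  by rewrite (negPf (yA i i it it nb)) (negPf xA) !orbF eq_sym.
case: ifPn => nbi; case: ifPn => nbl; first exact: dA.
- by rewrite disjoint_sym disjoint_setU1 yA // disjoint_sym dA.
- by rewrite disjoint_setU1 yA // dA.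
rewrite disjoint_setU1 [[disjoint A i & _]]disjoint_sym disjoint_setU1 yA //.
rewrite [[disjoint A l & _]]disjoint_sym dA // andbT in_setU1 negb_or yA // !andbT.
by apply: contraNneq nil => e; rewrite (yinj i l).
Qed.

(** Induction on [#|V|].  After shifting towards stability at a point [x], each
    family is replaced by its members avoiding [x] when these are numerous
    enough, and by its link at [x] otherwise; Pascal's rule for [bin_over] shows
    that one of the two satisfies the hypothesis on [V :\ x]. *)
Lemma rainbow_star t V F (k : nat -> nat) :
    (forall i, i < t -> F i \subset ksets V (k i)) -> \sum_(i < t) k i <= #|V| ->
    (forall i, i < t -> t.-1 * bin_over 1 #|V| (k i) < #|F i|) ->
  rainbow t F.
Proof.
have [n Vn] : exists n, #|V| = n by exists #|V|.
elim: n V F k Vn => [|n IHn] V F k Vn FV.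
  rewrite {1}Vn leqn0 => /eqP kV; apply: rainbow_star_tight => //.
  by rewrite Vn.
rewrite leq_eqVlt => /predU1P[kV|]; first exact: rainbow_star_tight.
rewrite Vn => kV bF.
have /card_gt0P[x xV] : 0 < #|V| by rewrite Vn.
apply: (rainbow_wlog_stable xV FV) => F' F'V cF stF.
have {}bF i : i < t -> t.-1 * bin_over 1 n.+1 (k i) < #|F' i| by move=> it; rewrite cF // bF.
move: F' F'V stF bF {cF FV F} => F FV stF bF.
pose D i := [set A in F i | x \notin A].
pose L i := [set A in ksets (V :\ x) (k i).-1 | x |: A \in F i].
pose b i := t.-1 * bin_over 1 n (k i) < #|D i|.
have cF i : i < t -> #|F i| <= #|L i| + #|D i|.
  move=> it; rewrite -(cardsID [set A : {set T} | x \in A] (F i)) leq_add //; last first.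
    by apply: eq_leq; apply: eq_card => A; rewrite !inE andbC.
  rewrite -(card_in_imset (f := fun A => A :\ x)); last first.
    move=> A B; rewrite !inE => /andP[_ xA] /andP[_ xB] e.
    by rewrite -(setD1K xA) -(setD1K xB) e.
  apply: subset_leq_card; apply/subsetP => _ /imsetP[A + ->].
  rewrite !inE => /andP[AF xA]; rewrite setD1K // AF andbT.
  have /setIdP[sAV /eqP <-] := subsetP (FV i it) _ AF.
  by rewrite setSD //= (cardsD1 x A) xA.
(* A family of sets of size 0 avoids [x], so it never takes the link branch. *)
have k0 i : i < t -> ~~ b i -> 0 < k i.
  move=> it; rewrite lt0n; apply: contra => /eqP ki.
  have FD : F i = D i.
    apply/setP => A; rewrite inE; case AF : (A \in F i) => //=.
    have /setIdP[_] := subsetP (FV i it) _ AF.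
    by rewrite ki cards_eq0 => /eqP->; rewrite inE.
  by have := bF i it; rewrite /b -FD ki.
have kle i : i < t -> k i <= n.
  move=> it; rewrite -ltnS; apply: leq_ltn_trans kV.
  by rewrite (bigD1 (Ordinal it)) //= leq_addr.
have Vx : #|V :\ x| = n by move: Vn; rewrite (cardsD1 x) xV => -[].
pose k' i := if b i then k i else (k i).-1.
pose G i := if b i then D i else L i.
have kk' i : i < t -> k i = k' i + ~~ b i.
  by move=> it; rewrite /k'; case: ifPn => [_|/(k0 i it)]; lia.
have GV i : i < t -> G i \subset ksets (V :\ x) (k' i).
  move=> it; rewrite /G /k'; case: ifP => _; apply/subsetP => A; rewrite inE.
    by move=> /andP[/(subsetP (FV i it))]; rewrite !inE subsetD1 => /andP[-> ->] ->.
  by case/andP.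
apply: (@rainbow_refill t V x F k k' b G) => //.
- by rewrite Vn ltnW.
- by move=> i A it bi; rewrite /G bi inE => /andP[].
- by move=> i A it /negPf nbi; rewrite /G nbi inE => /andP[].
apply: IHn GV _ _ => //; rewrite Vx.
  by rewrite -ltnS; apply: leq_ltn_trans kV; apply: leq_sum => i _; rewrite kk' // leq_addr.
move=> i it; rewrite /G /k'; case: ifPn => // nb.
have ki := k0 i it nb; have kn := kle i it; have := bF i it; have := cF i it.
rewrite bin_over_rec; last by lia.
rewrite -[in bin_over 2 _ _](prednK ki) bin_overSS mulnDr /=.
move: nb; rewrite /b -leqNgt => leD leF ltF.
rewrite -(ltn_add2r (t.-1 * bin_over 1 n (k i))).
by apply: leq_trans ltF (leq_trans leF _); rewrite leq_add2l.
Qed.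

End RainbowMatchings.

(** * Degrees and disjoint edges *)

Section Hypergraphs.
Variable T : finType.
Implicit Types (x v u : T) (V A B S U e : {set T}) (E M : {set {set T}}).

Definition deg E v := #|[set A in E | v \in A]|.

Lemma leq_deg E V k v : E \subset ksets V k -> v \in V -> deg E v <= bin_over 1 #|V| k.
Proof.
move=> EV vV; have := @card_over _ V [set v] k E EV; rewrite sub1set cards1 => /(_ vV).
by congr (_ <= _); apply: eq_card => A; rewrite !inE sub1set.
Qed.

Lemma leq_codeg E V k v u : E \subset ksets V k -> v \in V -> u \in V -> u != v ->
  deg [set A in E | v \in A] u <= bin_over 2 #|V| k.
Proof.
move=> EV vV uV nuv; have := @card_over _ V [set u; v] k E EV.
rewrite subUset !sub1set cards2 nuv uV vV => /(_ isT).
by congr (_ <= _); apply: eq_card => A; rewrite !inE subUset !sub1set -andbA (andbC (u \in A)).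
Qed.

Lemma card_meet E U : #|[set A in E | ~~ [disjoint A & U]]| <= \sum_(u in U) deg E u.
Proof.
apply: leq_trans (leq_card_bigcup _ _); apply: subset_leq_card.
apply/subsetP => A; rewrite inE => /andP[AE /pred0Pn[u /andP[uA uU]]].
by apply/bigcupP; exists u; rewrite // inE AE.
Qed.

Lemma card_codeg_meet E V k v U : E \subset ksets V k -> v \in V -> U \subset V ->
  v \notin U ->
  #|[set A in [set A in E | v \in A] | ~~ [disjoint A & U]]| <= #|U| * bin_over 2 #|V| k.
Proof.
move=> EV vV UV vU; apply: leq_trans (card_meet _ _) _.
rewrite -sum_nat_const; apply: leq_sum => u uU.
by apply: leq_codeg => //; [exact: (subsetP UV)|apply: contraNneq vU => <-].
Qed.

Lemma disjoint_edges_family t E (A : 'I_t -> {set T}) :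
    (forall i, A i \in E) -> (forall i, A i != set0) ->
    (forall i l, i != l -> [disjoint A i & A l]) ->
  has_disjoint_edges t E.
Proof.
move=> AE A0 dA; exists (A @: setT); split.
- by apply/subsetP => _ /imsetP[i _ ->].
- rewrite card_imset ?cardsT ?card_ord // => i l e.
  apply/eqP; apply: contraTT (A0 i) => /dA; rewrite -e -setI_eq0 setIid.
  by move->.
- apply/trivIsetP => _ _ /imsetP[i _ ->] /imsetP[l _ ->] ne.
  by apply: dA; apply: contraNneq ne => ->.
Qed.

(** The edges through [v] that avoid the rest of [S], deprived of [v], form a
    family of [(k - 1)]-sets outside [S].  At most [(t - 1) * bin_over 2 #|V| k]
    edges through [v] meet the rest of [S], so this family keeps more than
    [(t - 1) * bin_over 2 #|V| k] members, and [bin_over 2 #|V| k] is at least the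
    number of [(k - 1)]-sets through a point outside [S].  A rainbow matching of
    these families, with the points of [S] put back, consists of disjoint
    edges. *)
Lemma many_heavy_vertices t E V S k :
    0 < k -> E \subset ksets V k -> t * k <= #|V| -> S \subset V -> #|S| = t ->
    (forall v, v \in S -> 2 * t.-1 * bin_over 2 #|V| k < deg E v) ->
  has_disjoint_edges t E.
Proof.
move=> k0 EV tkV SV cS hS.
case: t => [|t] in tkV cS hS *.
  by exists set0; rewrite sub0set cards0; split=> //; apply/trivIsetP => A B; rewrite inE.
have /card_gt0P[x xS] : 0 < #|S| by rewrite cS.
pose v i := nth x (enum S) i.
have sS : size (enum S) = t.+1 by rewrite -cardE.
have vS i : i < t.+1 -> v i \in S by move=> it; rewrite -mem_enum mem_nth ?sS.
have vinj i l : i < t.+1 -> l < t.+1 -> v i = v l -> i = l.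
  by move=> it lt /eqP; rewrite nth_uniq ?enum_uniq ?sS // => /eqP.
pose F i := [set B in ksets (V :\: S) k.-1 | v i |: B \in E].
have FV i : i < t.+1 -> F i \subset ksets (V :\: S) k.-1.
  by move=> _; apply/subsetP => B /setIdP[].
have cVS : #|V :\: S| = #|V| - t.+1 by rewrite cardsD (setIidPr SV) cS.
have [|i it|B [BF dB]] := rainbow_star (k := fun=> k.-1) FV.
- rewrite sum_nat_const card_ord cVS leq_subRL.
    by rewrite -[X in X + _]muln1 -mulnDr add1n prednK.
  by apply: leq_trans tkV; rewrite leq_pmulr.
- have vi := vS i it; have viV := subsetP SV _ vi.
  have le2 : bin_over 1 #|V :\: S| k.-1 <= bin_over 2 #|V| k.
    rewrite -[in leqRHS](prednK k0) -[in leqRHS](prednK (_ : 0 < #|V|)).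
      by rewrite bin_overSS leq_bin_over // cVS; lia.
    by apply/card_gt0P; exists (v i).
  apply: leq_ltn_trans (_ : t * bin_over 2 #|V| k < _); first by rewrite leq_mul2l le2 orbT.
  rewrite -(ltn_add2r (t * bin_over 2 #|V| k)) addnn -mul2n mulnA.
  apply: leq_trans (hS _ vi) _; rewrite /deg.
  set Ev := [set A in E | v i \in A].
  rewrite -(cardsID [set A : {set T} | [disjoint A & S :\ v i]] Ev) leq_add //.
    rewrite -(card_in_imset (f := fun A => A :\ v i)); last first.
      move=> A1 A2; rewrite !inE => /andP[/andP[_ xA] _] /andP[/andP[_ xB] _] e.
      by rewrite -(setD1K xA) -(setD1K xB) e.
    apply: subset_leq_card; apply/subsetP => _ /imsetP[A + ->].
    rewrite !inE => /andP[/andP[AE viA] dA]; rewrite setD1K // AE andbT.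
    have /setIdP[sAV /eqP cA] := subsetP EV _ AE.
    rewrite subsetD (subset_trans (subD1set _ _)) //=.
    move: cA; rewrite (cardsD1 (v i)) viA add1n => <-; rewrite eqxx andbT.
    rewrite -setI_eq0; move: dA; rewrite -setI_eq0.
    by rewrite setIDA setIDAC.
  have -> : t = #|S :\ v i| by move: cS; rewrite (cardsD1 (v i)) vi => -[].
  apply: leq_trans (card_codeg_meet EV viV _ _); last 2 first.
  + exact: subset_trans (subD1set _ _) SV.
  + by rewrite !inE eqxx.
  by apply: eq_leq; apply: eq_card => A; rewrite !inE andbC.
have BS i : i < t.+1 -> [disjoint B i & S].
  by move=> /BF; rewrite !inE subsetD => /andP[/andP[/andP[]]].
have vB i l : i < t.+1 -> l < t.+1 -> v i \notin B l.
  by move=> it lt; have := BS l lt; rewrite disjoint_sym => /disjointFr ->; rewrite ?vS.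
apply: (@disjoint_edges_family _ _ (fun i => v i |: B i)) => [i|i|i l nil].
- by have := BF i (ltn_ord i); rewrite inE => /andP[].
- by apply/set0Pn; exists (v i); exact: setU11.
rewrite disjoint_setU1 [[disjoint B i & _]]disjoint_sym disjoint_setU1 vB //.
rewrite [[disjoint B l & _]]disjoint_sym dB // andbT in_setU1 negb_or vB // !andbT.
by apply: contraNneq nil => e; apply/eqP/val_inj; exact: (vinj _ _ (ltn_ord i) (ltn_ord l) e).
Qed.

Lemma extend_matching E M e : set0 \notin E -> M \subset E -> trivIset M -> e \in E ->
  [disjoint e & cover M] -> trivIset (e |: M) /\ #|e |: M| = #|M|.+1.
Proof.
move=> E0 ME tM eE deM.
have [|||tU eM] := @trivIsetU1 _ e M.
- by move=> B BM; apply: disjointWr deM; exact: bigcup_sup.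
- by [].
- by apply: contra E0; exact: (subsetP ME).
by rewrite cardsU1 eM.
Qed.

Lemma ksets_set0 E V k : 0 < k -> E \subset ksets V k -> set0 \notin E.
Proof.
move=> k0 EV; apply/negP => /(subsetP EV); rewrite inE cards0 => /andP[_ /eqP e].
by rewrite -e in k0.
Qed.

Lemma card_cover_le E V k M : E \subset ksets V k -> M \subset E ->
  cover M \subset V /\ #|cover M| <= #|M| * k.
Proof.
move=> EV ME; have MV A : A \in M -> A \subset V /\ #|A| = k.
  by move=> /(subsetP ME)/(subsetP EV); rewrite inE => /andP[-> /eqP].
split; first by apply/bigcupsP => A /MV[].
apply: leq_trans (leq_card_bigcup _ _) _; rewrite -sum_nat_const.
by apply: leq_sum => A /MV[_ ->].
Qed.

(** [t] disjoint edges avoiding [v] meet at most [t * k * bin_over 2 #|V| k] of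
    the edges through [v], so a further edge can be chosen through [v]. *)
Lemma heavy_vertex t E V k v :
    0 < k -> E \subset ksets V k -> v \in V -> t * k * bin_over 2 #|V| k < deg E v ->
    has_disjoint_edges t [set A in E | v \notin A] ->
  has_disjoint_edges t.+1 E.
Proof.
move=> k0 EV vV hv [M [ME' cM tM]].
have ME : M \subset E by apply: subset_trans ME' _; apply/subsetP => A /setIdP[].
have [sV] := card_cover_le EV ME; rewrite cM => cc.
have vM : v \notin cover M.
  by apply/bigcupP => -[A /(subsetP ME')/setIdP[_ /negP]].
have [e] : exists e, e \in [set A in E | v \in A] :\:
    [set A in [set A in E | v \in A] | ~~ [disjoint A & cover M]].
  apply/card_gt0P; rewrite cardsDS; last by apply/subsetP => A /setIdP[].
  rewrite subn_gt0; apply: leq_ltn_trans (card_codeg_meet EV vV sV vM) _.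
  by apply: leq_ltn_trans hv; rewrite leq_mul2r cc orbT.
rewrite !inE => /andP[+ /andP[eE ve]]; rewrite eE ve negbK => dE.
have [tU cU] := extend_matching (ksets_set0 k0 EV) ME tM eE dE.
by exists (e |: M); rewrite cU cM; split=> //; rewrite subUset sub1set eE.
Qed.

(** A matching of largest size among those with at most [t] edges can only be
    extended to one with [t.+1] edges. *)
Lemma maximal_matching t E : set0 \notin E -> ~ has_disjoint_edges t.+1 E ->
  exists M, [/\ M \subset E, #|M| <= t & forall e, e \in E -> ~~ [disjoint e & cover M]].
Proof.
move=> E0 nE; pose P M := [&& M \subset E, #|M| <= t & trivIset M].
have P0 : P set0 by rewrite /P sub0set cards0; apply/trivIsetP => A B; rewrite inE.
have [M /and3P[ME cM tM] maxM] := arg_maxnP (fun M => #|M|) P0.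
exists M; split=> // e eE; apply/negP => deM.
have [tU cU] := extend_matching E0 ME tM eE deM.
have sU : e |: M \subset E by rewrite subUset sub1set eE.
move: cM; rewrite leq_eqVlt => /predU1P[cM|lt]; first by apply: nE; exists (e |: M); rewrite cU cM.
have : #|e |: M| <= #|M| by apply: maxM; rewrite /P sU tU cU lt.
by rewrite cU ltnn.
Qed.

(** Every edge meets the set covered by a maximal matching.  At most [t] of its
    [t * k] points have degree above [2 * t * c], where [c] is
    [bin_over 2 #|V| k], and these still have degree at most [t * k * c]; the
    total is [t * k * (2 * t * c) + t * (t * k * c)]. *)
Lemma light_hypergraph t E V k :
    0 < k -> E \subset ksets V k -> t.+1 * k <= #|V| ->
    (forall v, v \in V -> deg E v <= t * k * bin_over 2 #|V| k) ->
    ~ has_disjoint_edges t.+1 E ->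
  #|E| <= 3 * k * t ^ 2 * bin_over 2 #|V| k.
Proof.
move=> k0 EV tkV light nE; set c := bin_over 2 _ _ in light *.
pose S := [set v in V | 2 * t * c < deg E v].
have cS : #|S| <= t.
  rewrite leqNgt; apply/negP => tS.
  have /card_gt0P[S'] : 0 < #|ksets S t.+1| by rewrite card_ksets bin_gt0.
  rewrite inE => /andP[sS' /eqP cS']; apply: nE.
  apply: (many_heavy_vertices k0 EV tkV _ cS') => [|v /(subsetP sS')].
    by apply: subset_trans sS' _; apply/subsetP => v /setIdP[].
  by rewrite inE => /andP[].
have [M [ME cM meetM]] := maximal_matching (ksets_set0 k0 EV) nE.
have [sMV cc] := card_cover_le EV ME.
have {}cc : #|cover M| <= t * k by apply: leq_trans cc _; rewrite leq_mul2r cM orbT.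
have -> : E = [set A in E | ~~ [disjoint A & cover M]].
  by apply/setP => A; rewrite inE; case AE : (A \in E) => //=; rewrite meetM.
apply: leq_trans (card_meet _ _) _.
apply: leq_trans (_ : \sum_(u in cover M) (2 * t * c + (u \in S) * (t * k * c)) <= _).
  apply: leq_sum => u /(subsetP sMV) uV; case: (boolP (u \in S)) => uS.
    by apply: leq_trans (light u uV) _; rewrite mul1n leq_addl.
  by rewrite addn0; move: uS; rewrite inE uV /= -leqNgt.
rewrite big_split /= sum_nat_const -big_distrl /=.
have le_S : \sum_(u in cover M) (u \in S) <= t.
  apply: leq_trans cS; rewrite -sum1_card [leqRHS]big_mkcond [leqLHS]big_mkcond /=.
  by apply: leq_sum => u _; case: ifP.
apply: leq_trans (leq_add (leq_mul cc (leqnn _)) (leq_mul le_S (leqnn _))) _.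
by apply: eq_leq; ring.
Qed.

(** Shifting [t] by one turns ['C(n - t + 1, k)] into ['C(n - t, k)].  Deleting a
    vertex loses at most [bin_over 1 #|V| k] edges, and the bound for [t - 1] on
    the remaining vertices is smaller by exactly that number, so the excess over
    the bound persists. *)
Lemma disjoint_edges_of_many t E V k :
    0 < k -> E \subset ksets V k -> 3 * k ^ 2 * t.+1 < #|V| ->
    'C(#|V|, k) - 'C(#|V| - t, k) < #|E| ->
  has_disjoint_edges t.+1 E.
Proof.
move=> k0; elim: t E V => [|t IHt] E V EV kV hE.
  have /card_gt0P[e eE] : 0 < #|E| by exact: leq_ltn_trans hE.
  exists [set e]; rewrite sub1set cards1; split=> //.
  by apply/trivIsetP => A B /set1P-> /set1P->; rewrite eqxx.
have kV' : t.+2 * k <= #|V| by nia.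
have ltV : t.+1 < #|V| by nia.
case: (boolP [exists v in V, t.+1 * k * bin_over 2 #|V| k < deg E v]).
  case/exists_inP => v vV hv; apply: (heavy_vertex k0 EV vV hv).
  have cV : #|V| = #|V :\ v|.+1 by rewrite (cardsD1 v) vV.
  apply: (IHt _ (V :\ v)).
  - apply/subsetP => A /setIdP[/(subsetP EV)]; rewrite !inE subsetD1.
    by move=> /andP[-> ->] ->.
  - rewrite cV in kV; nia.
  have cE : deg E v + #|[set A in E | v \notin A]| = #|E|.
    rewrite /deg -(cardsID [set A : {set T} | v \in A] E); congr (_ + _);
      by apply: eq_card => A; rewrite !inE // andbC.
  have ld := leq_deg EV vV.
  have := @bin_over_rec 0 #|V| k ltac:(lia).
  rewrite [bin_over 0 _ _]/bin_over [bin_over 0 _.-1 _]/bin_over /= !subn0 => eC.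
  move: hE ld eC; rewrite {}cV /= subSS => hE ld eC.
  have := @leq_bin2l (#|V :\ v| - t) #|V :\ v| k (leq_subr _ _).
  move: cE eC ld hE; move: (bin_over _ _ _) (deg E v) #|E| #|_| 'C(_, _) 'C(_, _) 'C(_, _).
  lia.
move=> /exists_inPn light.
case: (boolP [exists M : {set {set T}}, [&& M \subset E, #|M| == t.+2 & trivIset M]]).
  by case/existsP => M /and3P[ME /eqP cM tM]; exists M.
move=> /existsP nE.
have {}nE : ~ has_disjoint_edges t.+2 E.
  by case=> M [ME cM tM]; apply: nE; exists M; rewrite ME cM tM eqxx.
have leE : #|E| <= 3 * k * t.+1 ^ 2 * bin_over 2 #|V| k.
  by apply: light_hypergraph k0 EV kV' _ nE => v vV; rewrite leqNgt; exact: light.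
have leB : 3 * k * t.+1 ^ 2 * bin_over 2 #|V| k <= 'C(#|V|, k) - 'C(#|V| - t.+1, k).
  by apply: leq_light_bound => //; nia.
by have := leq_ltn_trans (leq_trans leE leB) hE; rewrite ltnn.
Qed.

End Hypergraphs.

Theorem theorem1p2 (n k t : nat) (n_gt0 : 0 < n) (k_gt0 : 0 < k) (t_gt0 : 0 < t)
    (t_small : (t%:R < n%:R / (3%:R * k%:R ^+ 2) :> rat)%R)
    (T : finType) (cardT : #|T| = n) (E : {set {set T}})
    (E_uniform : uniform_hypergraph k E)
    (E_free : ~ has_disjoint_edges t E) :
  #|E| <= 'C(n, k) - 'C(n - t + 1, k).
Proof.
have k2_gt0 : (0 < 3%:R * k%:R ^+ 2 :> rat)%R by rewrite mulr_gt0 ?exprn_gt0 ?ltr0n.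
have small : 3 * k ^ 2 * t < n.
  by move: t_small; rewrite ltr_pdivlMr // -natrX -!natrM ltr_nat mulnC.
have EV : E \subset ksets [set: T] k.
  by apply/subsetP => e /E_uniform ce; rewrite inE subsetT ce eqxx.
rewrite leqNgt; apply/negP => hE; apply: E_free.
have tn : t <= n by nia.
rewrite -(prednK t_gt0).
apply: (disjoint_edges_of_many k_gt0 EV); rewrite cardsT cardT ?prednK //.
by move: hE; rewrite (_ : n - t + 1 = n - t.-1) //; lia.
Qed.
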